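(* For every $n\ge3$, the star graph $S_n$ on $n$ vertices satisfies $$\frac{2\log(2)\left(1-\frac2n\right)}{\log(n-1)}\le\kappa(S_n)\le\frac{2\log 2}{\log n}.$$
   Context: Let $V$ be a finite set with $|V|=n$ and fix $x_*\in V$. The star graph $S_n$ is the weighted graph on $V$ with $c_{xy}=1$ if $x\ne y$ and $x_*\in\{x,y\}$, and $c_{xy}=0$ otherwise. For a weighted graph $G$ on $V$ with symmetric weights $c_{xy}\ge0$, $\kappa(G)$ is the largest $\kappa\ge0$ such that for all $f:V\to[0,\infty)$, $$\kappa\,\mathrm{Ent} f\le\frac2n\sum_{x,y\in V}c_{xy}\,\mathrm{ent}_{xy}f$$ (sum over ordered pairs), where $\mathrm{Ent} f=\mu[f\log(f/\mu(f))]$, $\mu$ is uniform on $V$, $0\log0=0$, and $$\mathrm{ent}_{xy}f=\tfrac12f(x)\log\frac{f(x)}{\frac12(f(x)+f(y))}+\tfrac12f(y)\log\frac{f(y)}{\frac12(f(x)+f(y))}.$$ *)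

(* Defs.v *)
From HB Require Import structures.
From mathcomp Require Import all_boot all_order all_algebra.
From mathcomp Require Import all_classical all_reals all_analysis.
From mathcomp Require Import ring lra.

Set Implicit Arguments.
Unset Strict Implicit.
Unset Printing Implicit Defensive.

Import Order.TTheory GRing.Theory Num.Theory.

Local Open Scope classical_set_scope.
Local Open Scope ring_scope.

Record weighted_graph (R : realType) (V : finType) := WeightedGraph {
  weight :> V -> V -> R;
  weight_sym : forall x y, weight x y = weight y x;
  weight_ge0 : forall x y, 0 <= weight x y
}.

Section Entropy.
Variables (R : realType) (V : finType).
Implicit Types (f : V -> R) (c : weighted_graph R V) (k : R).

Definition unif_mean f : R := (\sum_x f x) / #|V|%:R.

(* The convention 0 log 0 = 0 holds because 0 * _ = 0, whatever the values of
   [ln 0] and [ln (0 / 0)]. *)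
Definition Ent f : R := unif_mean (fun x => f x * ln (f x / unif_mean f)).

Definition ent f (x y : V) : R :=
  2^-1 * (f x * ln (f x / (2^-1 * (f x + f y)))) +
  2^-1 * (f y * ln (f y / (2^-1 * (f x + f y)))).

Definition entropy_ineq c k : Prop :=
  forall f, (forall x, 0 <= f x) ->
    k * Ent f <= 2 / #|V|%:R * \sum_x \sum_y c x y * ent f x y.

(* By [kappa_largest] below, the supremum is attained as soon as #|V| > 1. *)
Definition kappa c : R := sup [set k | 0 <= k /\ entropy_ineq c k].

Lemma ent_ge0 f x y : 0 <= f x -> 0 <= f y -> 0 <= ent f x y.
Proof.
have lnge (t : R) : 0 < t -> 1 - t^-1 <= ln t.
  move=> t0; have ti : 0 < t^-1 by rewrite invr_gt0.
  have := @le_ln1Dx R (t^-1 - 1); rewrite ltrBrDl subrr => /(_ ti).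
  by rewrite addrC subrK lnV ?posrE //; lra.
have term (a b : R) : 0 <= a -> 0 <= b ->
    a - 2^-1 * (a + b) <= a * ln (a / (2^-1 * (a + b))).
  rewrite le_eqVlt => /predU1P[<-|a0] b0; first by rewrite mul0r; lra.
  have s0 : 0 < 2^-1 * (a + b) by lra.
  have := lnge _ (divr_gt0 a0 s0); rewrite -(ler_pM2l a0) mulrBr mulr1 invf_div.
  by rewrite [a * (_ / a)]mulrC divfK ?gt_eqF.
move=> fx fy; rewrite /ent.
have h1 := term _ _ fx fy; have := term _ _ fy fx.
by rewrite [f y + f x]addrC => h2; lra.
Qed.

Lemma kappa_largest c : (1 < #|V|)%N ->
  [/\ 0 <= kappa c, entropy_ineq c (kappa c) &
      forall k, 0 <= k -> entropy_ineq c k -> k <= kappa c].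
Proof.
move=> V1; set n : R := #|V|%:R.
have n1 : 1 < n by rewrite ltr1n.
have n0 : 0 < n by apply: lt_trans n1.
pose rhs f := 2 / n * \sum_x \sum_y c x y * ent f x y.
have rhs0 f : (forall x, 0 <= f x) -> 0 <= rhs f.
  move=> f0; apply: mulr_ge0; first by rewrite divr_ge0 // ltW.
  by do 2 apply: sumr_ge0 => ? _; rewrite mulr_ge0 ?weight_ge0 ?ent_ge0.
have K0 : [set k | 0 <= k /\ entropy_ineq c k] 0.
  by split=> // f f0; rewrite mul0r; exact: rhs0.
have [z _] : exists z : V, z \in V by apply/card_gt0P; apply: ltnW.
pose d x : R := (x == z)%:R.
have d0 x : 0 <= d x by rewrite /d ler0n.
have Ed : 0 < Ent d.
  have md : unif_mean d = n^-1.
    rewrite /unif_mean (bigD1 z) //= big1 => [|x /negPf xz]; last by rewrite /d xz.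
    by rewrite /d eqxx addr0 mul1r.
  rewrite /Ent {1}/unif_mean md (bigD1 z) //= big1 => [|x /negPf xz].
    by rewrite /d eqxx addr0 !mul1r invrK divr_gt0 // ln_gt0.
  by rewrite /d xz mul0r.
have hub : has_ubound [set k | 0 <= k /\ entropy_ineq c k].
  exists (rhs d / Ent d) => k [_ /(_ d d0)].
  by rewrite ler_pdivlMr.
have hn : [set k | 0 <= k /\ entropy_ineq c k] !=set0 by exists 0.
split=> [|f f0|k k0 kc].
- exact: ub_le_sup.
- rewrite -/(rhs f); have [E0|E0] := ltP 0 (Ent f).
    rewrite -ler_pdivlMr //; apply: ge_sup => // k [_ /(_ f f0)].
    by rewrite ler_pdivlMr.
  apply: le_trans (rhs0 f f0); apply: mulr_ge0_le0 => //.
  exact: ub_le_sup.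
- exact: ub_le_sup.
Qed.

Variable xs : V.

Definition star_weight (x y : V) : R :=
  ((x != y) && ((xs == x) || (xs == y)))%:R.

Fact star_weight_sym x y : star_weight x y = star_weight y x.
Proof. by rewrite /star_weight eq_sym orbC. Qed.

Fact star_weight_ge0 x y : 0 <= star_weight x y.
Proof. exact: ler0n. Qed.

Definition star_graph : weighted_graph R V :=
  WeightedGraph star_weight_sym star_weight_ge0.

End Entropy.

Arguments star_graph R {V} xs.

(* Main.v *)
Require Import Defs.
From mathcomp Require Import all_boot all_order all_algebra.
From mathcomp Require Import all_classical all_reals all_analysis.
From mathcomp Require Import ring lra.

Import Order.TTheory GRing.Theory Num.Theory.

Local Open Scope ring_scope.

(* The upper bound comes from a point mass at a leaf. For the lower bound, put
   u = sqrt f. The elementary inequality 2 ent_xy f >= ln 2 (u x - u y)^2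
   bounds the right-hand side below by (2 ln 2 / n) sum_x (u x - u xs)^2, which
   is at least 2 ln 2 Var u; one concludes by the sharp logarithmic Sobolev
   inequality on the complete graph (Diaconis and Saloff-Coste),
   Ent (u^2) <= (n ln (n-1) / (n-2)) Var u. The latter is obtained by induction
   on n from its two-point version. Both two-point inequalities express that
   the binary entropy of s is a convex function of sqrt (s (1-s)): the first is
   a chord inequality, the second a tangent one. *)

(** * Calculus of the logarithm and of the binary entropy *)

Section Calculus.
Variable R : realType.
Implicit Types (f df : R -> R) (a b k s t x y z : R).

Lemma is_derive_ndecr f df a b : a <= b ->
  (forall x, a <= x <= b -> is_derive x 1 f (df x)) ->
  (forall x, a <= x <= b -> 0 <= df x) -> f a <= f b.
Proof.
move=> ab fdf df0.
have [||c /[!in_itv]/= cab E] := @MVT_segment R f df a b ab.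
- by move=> x /[!in_itv]/= /andP[/ltW ax /ltW xb]; apply: fdf; rewrite ax.
- apply: derivable_within_continuous => x /[!in_itv]/= xab.
  exact: (@ex_derive _ _ _ _ _ _ _ (fdf x xab)).
- by rewrite -subr_ge0 E mulr_ge0 ?df0 // subr_ge0.
Qed.

(** The two sides agree at 1, and their difference has derivative [(x - 1)^2 / (x (x + 1)^2)]. *)
Lemma ln_ge_pade t : 1 <= t -> 2 * (t - 1) / (t + 1) <= ln t.
Proof.
move=> t1.
pose f x : R := ln x + 4 * (x + 1)^-1.
suff : f 1 <= f t.
  rewrite /f ln1 add0r.
  have -> : 2 * (t - 1) / (t + 1) = 2 - 4 * (t + 1)^-1 by field; lra.
  have -> : 4 * (1 + 1)^-1 = 2 :> R by field.
  lra.
apply: (@is_derive_ndecr f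
  (fun x => (x - 1) ^+ 2 / (x * (x + 1) ^+ 2))) => // x /andP[x1 _].
- have x0 : 0 < x by lra.
  have x10 : x + 1 != 0 by lra.
  have lnx := is_derive1_ln x0.
  apply: is_derive_eq.
  rewrite /GRing.scale/=; field; lra.
- by rewrite divr_ge0 ?sqr_ge0 // mulr_ge0 ?sqr_ge0 //; lra.
Qed.

Lemma ln_le_pade t : 1 <= t -> 2 * ln t <= t - t^-1.
Proof.
move=> t1.
pose f x : R := x - x^-1 - 2 * ln x.
suff : f 1 <= f t by rewrite /f ln1 invr1; lra.
apply: (@is_derive_ndecr f
  (fun x => ((x - 1) / x) ^+ 2)) => // x /andP[x1 _].
- have x0 : 0 < x by lra.
  have xN0 : x != 0 by lra.
  have lnx := is_derive1_ln x0.
  have invx : is_derive x 1 (fun y : R => y^-1) (- x ^- 2 * 1).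
    exact: (@is_deriveV _ id).
  apply: is_derive_eq.
  rewrite /GRing.scale/=; field; lra.
- by rewrite sqr_ge0.
Qed.

(* The constant for [t + 1] points; 2 is its limit at [t = 1]. *)
Definition lsi_const t : R := if t == 1 then 2 else (t + 1) * ln t / (t - 1).

(** The derivative is nonnegative by [ln_le_pade], and the limit value 2 at [s = 1] is handled by
    [ln_ge_pade]. This lets the constant grow in the induction on the number of points. *)
Lemma lsi_const_mono s t : 1 <= s -> s <= t -> lsi_const s <= lsi_const t.
Proof.
move=> s1 st; rewrite /lsi_const.
have [tE|tN1] := eqVneq t 1.
  by have -> : s = 1 by [lra]; rewrite eqxx.
have t1 : 1 < t by rewrite lt_neqAle eq_sym tN1 (le_trans s1).
have [_|sN1] := eqVneq s 1.
  rewrite ler_pdivlMr ?subr_gt0 //.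
  have := ln_ge_pade _ (ltW t1); rewrite ler_pdivrMr; lra.
have {s1 sN1} s1 : 1 < s by rewrite lt_neqAle eq_sym sN1.
pose f x : R := ln x + 2 * (ln x * (x - 1)^-1).
suff : f s <= f t.
  have E x : 1 < x -> (x + 1) * ln x / (x - 1) = f x.
    by rewrite /f => x1; field; lra.
  by rewrite !E.
apply: (@is_derive_ndecr f
  (fun x => (x - x^-1 - 2 * ln x) / (x - 1) ^+ 2)) => // x /andP[sx _].
- have x0 : 0 < x by lra.
  have xN0 : x - 1 != 0 by lra.
  have lnx := is_derive1_ln x0.
  apply: is_derive_eq.
  rewrite /GRing.scale/=; field; apply/andP; split; lra.
- have : 1 <= x by lra.
  by move=> /ln_le_pade ?; rewrite divr_ge0 ?sqr_ge0 //; lra.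
Qed.

Lemma lsi_const_ge2 t : 1 <= t -> 2 <= lsi_const t.
Proof.
move=> t1; have := lsi_const_mono _ _ (lexx 1) t1.
by rewrite {1}/lsi_const eqxx.
Qed.

(* That is, [z ln z / (z^2 - 1)], extended by continuity at [z = 1]. *)
Definition ent_slope z : R := lsi_const (z ^+ 2) * z / (2 * (z ^+ 2 + 1)).

Lemma ent_slopeE z : 1 <= z -> ent_slope z * (z ^+ 2 - 1) = z * ln z.
Proof.
move=> z1; rewrite /ent_slope /lsi_const.
have z2 : 0 <= z ^+ 2 by rewrite sqr_ge0.
have [zE|zN1] := eqVneq (z ^+ 2) 1.
  have -> : z = 1 by apply/eqP; rewrite -(@eqrXn2 _ 2) ?expr1n ?zE //; lra.
  by rewrite ln1 expr1n subrr !mulr0.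
rewrite lnXn; last lra.
have : z ^+ 2 - 1 != 0 by rewrite subr_eq0.
by move=> ?; field; apply/andP; split=> //; lra.
Qed.

(** Away from 1, the sign of the derivative is decided by [ln_ge_pade] at [x ^+ 2]; the comparison
    with the limit [ent_slope 1 = 1/2] is [ln_le_pade]. *)
Lemma ent_slope_nincr y z : 1 <= y -> y <= z -> ent_slope z <= ent_slope y.
Proof.
move=> y1 yz.
have [->|zN1] := eqVneq z y; first by [].
have z1 : 1 < z by rewrite (le_lt_trans y1) // lt_neqAle eq_sym zN1.
have E x : 1 < x -> ent_slope x = x * ln x / (x ^+ 2 - 1).
  move=> x1; rewrite -ent_slopeE ?ltW // mulfK //.
  have : 1 < x ^+ 2 by rewrite exprn_egt1.
  lra.
have [->|yN1] := eqVneq y 1.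
  have -> : ent_slope 1 = 2^-1.
    by rewrite /ent_slope /lsi_const expr1n eqxx; field.
  rewrite E // ler_pdivrMr; last by rewrite subr_gt0 exprn_egt1.
  have := ln_le_pade _ (ltW z1).
  have -> : z - z^-1 = (z ^+ 2 - 1) / z by field; lra.
  by rewrite ler_pdivlMr; lra.
have {y1 yN1} y1 : 1 < y by rewrite lt_neqAle eq_sym yN1.
pose f x : R := - (ln x * (x * (x ^+ 2 - 1)^-1)).
suff : f y <= f z by rewrite /f !E // ![_ * ln _]mulrC -!mulrA lerN2.
apply: (@is_derive_ndecr f
  (fun x => ((x ^+ 2 + 1) * ln x - (x ^+ 2 - 1)) / (x ^+ 2 - 1) ^+ 2))
  => // x /andP[yx _].
- have x0 : 0 < x by lra.
  have xN0 : x ^+ 2 - 1 != 0 by rewrite gt_eqF // subr_gt0 exprn_egt1 //; lra.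
  have lnx := is_derive1_ln x0.
  apply: is_derive_eq.
  by rewrite /GRing.scale/= ?expr1; field; apply/andP; split=> //; lra.
- rewrite divr_ge0 ?sqr_ge0 //.
  have x2 : 1 <= x ^+ 2 by rewrite exprn_ege1 //; lra.
  have := ln_ge_pade _ x2; rewrite lnXn; last lra.
  by rewrite ler_pdivrMr; lra.
Qed.

(* With [s = z^2 / (z^2 + 1)], [bin_ent z] is the binary entropy of [s] and
   [bin_gmean z = sqrt (s (1 - s))]. *)
Definition bin_ent z : R :=
  ln (z ^+ 2 + 1) - 2 * ln z + 2 * (ln z * (z ^+ 2 + 1)^-1).
Definition bin_gmean z : R := z / (z ^+ 2 + 1).

(* As [ent_slope] and [bin_gmean] both decrease on [z >= 1], [bin_ent] is a
   convex function of [bin_gmean], with slope [4 * ent_slope]. *)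
Lemma bin_ent_tangent k z : 1 <= k -> 1 <= z ->
  bin_ent k + 4 * ent_slope k * (bin_gmean z - bin_gmean k) <= bin_ent z.
Proof.
move=> k1 z1.
(* Up to a constant, [f] is the gap between [bin_ent] and its tangent; it decreases on [[1, k]] and
   increases beyond, so its minimum is at [k]. *)
pose f x : R := bin_ent x - 4 * ent_slope k * (x * (x ^+ 2 + 1)^-1).
pose df x : R :=
  4 * (x ^+ 2 - 1) * (ent_slope k - ent_slope x) / (x ^+ 2 + 1) ^+ 2.
suff : f k <= f z by rewrite /f /bin_gmean; lra.
have fdf x : 1 <= x -> is_derive x 1 f (df x).
  move=> x1; have x0 : 0 < x by lra.
  have x20 : 0 < x ^+ 2 + 1 by rewrite ltr_wpDl ?sqr_ge0.
  have x2N0 : x ^+ 2 + 1 != 0 by rewrite gt_eqF.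
  have lnx := is_derive1_ln x0.
  have lnx2 : is_derive x 1 (fun x : R => ln (x ^+ 2 + 1))
      (2 * x / (x ^+ 2 + 1)).
    have lnx2 := is_derive1_ln x20.
    apply: (@is_derive_eq _ _ _ _ _ _ _ _ (is_derive1_comp _ _)).
    by rewrite /GRing.scale/= ?expr1; field.
  rewrite /f /bin_ent; apply: is_derive_eq.
  have -> : df x =
      (4 * (x ^+ 2 - 1) * ent_slope k - 4 * (x * ln x)) / (x ^+ 2 + 1) ^+ 2.
    by rewrite /df -ent_slopeE //; congr (_ / _); ring.
  by rewrite /GRing.scale/= ?expr1; field; apply/andP; split=> //; lra.
have sq x : 1 <= x -> 0 <= 4 * (x ^+ 2 - 1).
  by move=> x1; rewrite mulr_ge0 // subr_ge0 exprn_ege1.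
have [kz|/ltW zk] := leP k z.
  apply: (@is_derive_ndecr f df) => // x /andP[kx _].
    by apply: fdf; lra.
  rewrite divr_ge0 ?sqr_ge0 // mulr_ge0 ?sq ?(le_trans k1) //.
  by rewrite subr_ge0 ent_slope_nincr.
rewrite -lerN2.
apply: (@is_derive_ndecr (fun x => - f x)
  (fun x => - df x)) => // x /andP[zx xk].
  by apply: is_deriveN; apply: fdf; lra.
have -> : - df x =
    4 * (x ^+ 2 - 1) * (ent_slope x - ent_slope k) / (x ^+ 2 + 1) ^+ 2.
  by rewrite /df; ring.
rewrite divr_ge0 ?sqr_ge0 // mulr_ge0 ?sq ?(le_trans z1) //.
by rewrite subr_ge0 ent_slope_nincr // (le_trans z1).
Qed.

(** This is the height of the tangent at [k] above [bin_gmean = 0]; the [ln k] terms cancel by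
    [ent_slopeE]. *)
Lemma bin_ent_intercept k : 1 <= k ->
  bin_ent k - 4 * ent_slope k * bin_gmean k =
  ln (k ^+ 2 + 1) - 2 * ent_slope k * k.
Proof.
move=> k1; have k20 : 0 < k ^+ 2 + 1 by rewrite ltr_wpDl ?sqr_ge0.
have -> : 4 * ent_slope k * bin_gmean k =
    2 * ent_slope k * k - 2 * k * (ent_slope k * (k ^+ 2 - 1)) / (k ^+ 2 + 1).
  by rewrite /bin_gmean; field; lra.
by rewrite ent_slopeE // /bin_ent; field; lra.
Qed.

(** Inverting [z] exchanges [s] and [1 - s]. *)
Lemma bin_entV z : 0 < z -> bin_ent z^-1 = bin_ent z.
Proof.
move=> z0; have z20 : 0 < z ^+ 2 + 1 by rewrite ltr_wpDl ?sqr_ge0.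
rewrite /bin_ent lnV ?posrE //.
have -> : z^-1 ^+ 2 + 1 = (z ^+ 2 + 1) / z ^+ 2 by field; lra.
rewrite ln_div ?posrE ?exprn_gt0 // lnXn //.
by field; apply/andP; split; lra.
Qed.

Lemma bin_gmeanV z : 0 < z -> bin_gmean z^-1 = bin_gmean z.
Proof.
move=> z0; have z20 : 0 < z ^+ 2 + 1 by rewrite ltr_wpDl ?sqr_ge0.
by rewrite /bin_gmean; field; do ?[apply/andP; split]; lra.
Qed.

Lemma bin_ent_tangent_pos k z : 1 <= k -> 0 < z ->
  bin_ent k + 4 * ent_slope k * (bin_gmean z - bin_gmean k) <= bin_ent z.
Proof.
move=> k1 z0; have [z1|/ltW z1] := leP 1 z; first exact: bin_ent_tangent.
by rewrite -(bin_entV _ z0) -(bin_gmeanV _ z0) bin_ent_tangent // invf_ge1.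
Qed.

(** After removing [ln t] from both sides, [ln (1 + 1/t) <= 1/t <= ln t / (t - 1)] remains. With
    [t = z ^+ 2] it says that the tangent at [z] has nonpositive intercept. *)
Lemma ln_succ_le_lsi_const t : 1 <= t ->
  ln (t + 1) <= lsi_const t * t / (t + 1).
Proof.
move=> t1; rewrite /lsi_const; have [->|tN1] := eqVneq t 1.
  have := @le_ln1Dx R 1; rewrite (_ : -1 < 1); last lra.
  by move=> /(_ isT); have -> : 2 * 1 / (1 + 1) = 1 :> R by field.
have {t1 tN1} t1 : 1 < t by rewrite lt_neqAle eq_sym tN1.
have h1 : ln (1 + t^-1) <= t^-1.
  by apply: le_ln1Dx; have : 0 < t^-1 by [rewrite invr_gt0; lra]; lra.
have h2 : 1 - t^-1 <= ln t.
  have : ln (1 + (t^-1 - 1)) <= t^-1 - 1.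
    by apply: le_ln1Dx; have : 0 < t^-1 by [rewrite invr_gt0; lra]; lra.
  by rewrite addrC subrK lnV ?posrE; lra.
have -> : ln (t + 1) = ln t + ln (1 + t^-1).
  rewrite -lnM ?posrE; try lra.
    by rewrite mulrDr mulr1 divff //; lra.
  by have : 0 < t^-1 by [rewrite invr_gt0; lra]; lra.
have -> : (t + 1) * ln t / (t - 1) * t / (t + 1) = ln t + ln t / (t - 1).
  by field; apply/andP; split; lra.
rewrite lerD2l (le_trans h1) // ler_pdivlMr; last lra.
apply: le_trans h2; rewrite mulrBr mulr1 mulVf; lra.
Qed.

(** The chord joins [(0, 0)] to [(1/2, ln 2)]. The tangent at [z] lies below both endpoints;
    averaging these two facts with weights [1 - 2 * bin_gmean z] and [2 * bin_gmean z] avoids a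
    limit at infinity. *)
Lemma bin_ent_chord z : 1 <= z -> bin_ent z <= 2 * ln 2 * bin_gmean z.
Proof.
move=> z1; have z20 : 0 < z ^+ 2 + 1 by rewrite ltr_wpDl ?sqr_ge0.
have := bin_ent_tangent _ _ z1 (lexx 1).
have -> : bin_ent 1 = ln 2.
  by rewrite /bin_ent ln1 expr1n mul0r !mulr0 subr0 addr0.
have -> : bin_gmean 1 = 2^-1 by rewrite /bin_gmean expr1n mul1r.
have Z0 : 0 <= bin_gmean z by rewrite divr_ge0 //; lra.
have Z1 : bin_gmean z <= 2^-1.
  rewrite /bin_gmean ler_pdivrMr //.
  by have := sqr_ge0 (z - 1); rewrite sqrrB1; lra.
have h : bin_ent z <= 4 * ent_slope z * bin_gmean z.
  have z2 : 1 <= z ^+ 2 by rewrite exprn_ege1.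
  have := ln_succ_le_lsi_const _ z2.
  have -> : lsi_const (z ^+ 2) * z ^+ 2 / (z ^+ 2 + 1) = 2 * ent_slope z * z.
    by rewrite /ent_slope; field; lra.
  have := bin_ent_intercept _ z1; lra.
move=> h'.
have Z2 : 0 <= 1 - 2 * bin_gmean z by lra.
have := ler_wpM2l Z2 h; have := ler_wpM2l Z0 h'; lra.
Qed.

(** A logarithmic Sobolev inequality for two points of masses 1 and [t]; the last factor is [t + 1]
    times the variance. *)
Lemma two_point_lsi t x y : 1 <= t -> 0 <= y <= x ->
  x ^+ 2 * ln (x ^+ 2) + t * (y ^+ 2 * ln (y ^+ 2))
    - (x ^+ 2 + t * y ^+ 2) * ln ((x ^+ 2 + t * y ^+ 2) / (t + 1))
  <= lsi_const t * (t / (t + 1) * (x - y) ^+ 2).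
Proof.
move=> t1 /andP[]; rewrite le_eqVlt => /predU1P[<-|y0] yx.
  rewrite expr0n !(mul0r, mulr0) !addr0 subr0.
  move: yx; rewrite le_eqVlt => /predU1P[<-|x0].
    by rewrite expr0n !(mul0r, mulr0) subrr.
  rewrite ln_div ?posrE ?exprn_gt0 //; last lra.
  have := ler_wpM2l (sqr_ge0 x) (ln_succ_le_lsi_const _ t1); lra.
have x0 : 0 < x by rewrite (lt_le_trans y0).
pose k := Num.sqrt t.
have kt : t = k ^+ 2 by rewrite sqr_sqrtr //; lra.
have k1 : 1 <= k by rewrite -sqrtr1 ler_wsqrtr.
have k0 : 0 < k by lra.
(* Thus [z^2 / (z^2 + 1)] is the share of [x^2] in [x^2 + t y^2]. The equality case [x = y] is
   [z = k^-1], which inversion sends to [k]: hence the tangent at [k]. *)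
have [z z0 xE] : exists2 z, 0 < z & x = z * (k * y).
  exists (x / (k * y)); first by rewrite divr_gt0 ?mulr_gt0.
  by rewrite divfK // mulf_neq0 ?gt_eqF.
have k20 : 0 < k ^+ 2 + 1 by rewrite ltr_wpDl ?sqr_ge0.
have z20 : 0 < z ^+ 2 + 1 by rewrite ltr_wpDl ?sqr_ge0.
have lnx : ln (x ^+ 2) = 2 * (ln z + ln k + ln y).
  rewrite lnXn // xE lnM ?posrE ?mulr_gt0 // lnM ?posrE //; lra.
have lns : ln ((x ^+ 2 + t * y ^+ 2) / (t + 1)) =
    2 * ln k + 2 * ln y + ln (z ^+ 2 + 1) - ln (k ^+ 2 + 1).
  have -> : x ^+ 2 + t * y ^+ 2 = (k * y) ^+ 2 * (z ^+ 2 + 1).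
    by rewrite xE kt; ring.
  rewrite kt ln_div ?posrE ?mulr_gt0 ?exprn_gt0 ?mulr_gt0 //.
  rewrite lnM ?posrE ?exprn_gt0 ?mulr_gt0 // lnXn ?mulr_gt0 //.
  rewrite lnM ?posrE //; lra.
rewrite lnx lns lnXn //.
have h := bin_ent_tangent_pos _ _ k1 z0.
have {h} :
    ln (k ^+ 2 + 1) - 2 * ent_slope k * k + 4 * ent_slope k * bin_gmean z
    <= bin_ent z.
  by rewrite -bin_ent_intercept //; lra.
rewrite -(ler_pM2l z20).
have -> : (z ^+ 2 + 1) * bin_ent z =
    (z ^+ 2 + 1) * ln (z ^+ 2 + 1) - 2 * z ^+ 2 * ln z.
  by rewrite /bin_ent; field; lra.
have -> :
    (z ^+ 2 + 1) * (ln (k ^+ 2 + 1) - 2 * ent_slope k * k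
                    + 4 * ent_slope k * bin_gmean z) =
    (z ^+ 2 + 1) * (ln (k ^+ 2 + 1) - 2 * ent_slope k * k)
    + 4 * ent_slope k * z.
  by rewrite /bin_gmean; field; lra.
move=> h.
(* The term in [k ^+ 2 - 1] is isolated because [ent_slopeE] turns it into the [2 * ln k] left over
   on the other side. *)
have -> : lsi_const t * (t / (t + 1) * (x - y) ^+ 2) =
    (k * y) ^+ 2 * (2 * ent_slope k * (z ^+ 2 + 1) * k - 4 * ent_slope k * z
                    - 2 * (ent_slope k * (k ^+ 2 - 1)) / k).
  by rewrite /ent_slope -kt xE kt; field; do ?[apply/andP; split]; lra.
rewrite ent_slopeE //.
have -> : 2 * (k * ln k) / k = 2 * ln k by field; lra.
have ky0 : 0 <= (k * y) ^+ 2 by rewrite sqr_ge0.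
rewrite xE kt; have := ler_wpM2l ky0 h; lra.
Qed.

(** For [x = z * y], dividing by [x^2 + y^2] leaves [ln 2 * (1 - 2 * bin_gmean z) <= ln 2 - bin_ent
    z], which is [bin_ent_chord]. *)
Lemma two_point_hellinger x y : 0 <= x -> 0 <= y ->
  ln 2 * (x - y) ^+ 2 <=
  x ^+ 2 * ln (x ^+ 2 / (2^-1 * (x ^+ 2 + y ^+ 2))) +
  y ^+ 2 * ln (y ^+ 2 / (2^-1 * (x ^+ 2 + y ^+ 2))).
Proof.
wlog yx : x y / y <= x.
  move=> H x0 y0; have [yx|/ltW xy] := leP y x; first exact: H.
  have -> : (x - y) ^+ 2 = (y - x) ^+ 2 by ring.
  by rewrite [X in _ <= X]addrC [x ^+ 2 + y ^+ 2]addrC; exact: H.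
move=> _; rewrite le_eqVlt => /predU1P[<-|y0].
  rewrite expr0n !(mul0r, addr0) subr0.
  have [->|x0] := eqVneq x 0; first by rewrite expr0n mulr0 mul0r.
  have -> : x ^+ 2 / (2^-1 * x ^+ 2) = 2 by field.
  by rewrite mulrC.
have x0 : 0 < x by rewrite (lt_le_trans y0).
have [z z1 xE] : exists2 z, 1 <= z & x = z * y.
  exists (x / y); first by rewrite ler_pdivlMr // mul1r.
  by rewrite divfK // gt_eqF.
have z0 : 0 < z by lra.
have z20 : 0 < z ^+ 2 + 1 by rewrite ltr_wpDl ?sqr_ge0.
have -> : x ^+ 2 / (2^-1 * (x ^+ 2 + y ^+ 2)) = 2 * z ^+ 2 / (z ^+ 2 + 1).
  have s0 : 0 < (z * y) ^+ 2 + y ^+ 2 by rewrite addr_gt0 ?exprn_gt0 ?mulr_gt0.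
  by rewrite xE; field; apply/andP; split; lra.
have -> : y ^+ 2 / (2^-1 * (x ^+ 2 + y ^+ 2)) = 2 / (z ^+ 2 + 1).
  have s0 : 0 < (z * y) ^+ 2 + y ^+ 2 by rewrite addr_gt0 ?exprn_gt0 ?mulr_gt0.
  by rewrite xE; field; apply/andP; split; lra.
rewrite !ln_div ?posrE ?mulr_gt0 ?exprn_gt0 // lnM ?posrE ?exprn_gt0 // lnXn //.
have := bin_ent_chord _ z1; rewrite -(ler_pM2l z20).
have -> : (z ^+ 2 + 1) * bin_ent z =
    (z ^+ 2 + 1) * ln (z ^+ 2 + 1) - 2 * z ^+ 2 * ln z.
  by rewrite /bin_ent; field; lra.
have -> : (z ^+ 2 + 1) * (2 * ln 2 * bin_gmean z) = 2 * ln 2 * z.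
  by rewrite /bin_gmean; field; lra.
move=> h; rewrite xE; have := ler_wpM2l (sqr_ge0 y) h; lra.
Qed.

End Calculus.

(** * Logarithmic Sobolev inequality on the complete graph *)

Section CompleteGraph.
Variables (R : realType) (V : finType).
Implicit Types (A : {set V}) (u f : V -> R).

(* The induction removes the largest value of [u] and compares it, through
   [two_point_lsi], with the quadratic mean [b] of the others. Their arithmetic
   mean [t] is smaller, which is paid for by [b <= u z]. *)
Lemma complete_lsi_set m A u : (forall x, 0 <= u x) -> #|A| = m.+1 ->
  \sum_(x in A) u x ^+ 2 * ln (u x ^+ 2)
    - (\sum_(x in A) u x ^+ 2) * ln ((\sum_(x in A) u x ^+ 2) / m.+1%:R)
  <= lsi_const R (maxn 1 m)%:R *
     (\sum_(x in A) u x ^+ 2 - (\sum_(x in A) u x) ^+ 2 / m.+1%:R).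
Proof.
move=> u0; elim: m A => [|m IH] A cA.
  have /cards1P[z ->] : #|A| == 1%N by rewrite cA.
  by rewrite !big_set1 !divr1 !subrr mulr0.
have [z0 z0A] : exists z, z \in A by apply/card_gt0P; rewrite cA.
have [z zA zmax] := @arg_maxP _ R V z0 (mem A) u z0A.
have {}zA : z \in A := zA.
set c1 := lsi_const R (maxn 1 m.+1)%:R.
have cA' : #|A :\ z| = m.+1 by apply/eqP; rewrite -eqSS -cA (cardsD1 z A) zA.
have sumD1 (g : V -> R) : \sum_(x in A) g x = g z + \sum_(x in A :\ z) g x.
  by rewrite (big_setD1 z).
have := IH _ cA'; rewrite !sumD1.
set X := \sum_(_ in A :\ z) _ * _; set S := \sum_(_ in A :\ z) _ ^+ _.
set T := \sum_(_ in A :\ z) _; set M : R := m.+1%:R.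
have M1 : 1 <= M by rewrite ler1n.
have M0 : 0 < M by lra.
have -> : m.+2%:R = M + 1 :> R by rewrite natr1.
set c0 := lsi_const _ _ => IHX.
(* For [m = 0] the [maxn] keeps the argument at 1, within the range of [lsi_const_mono]. *)
have c0c1 : c0 <= c1.
  apply: lsi_const_mono; rewrite ?ler1n ?leq_max ?ler_nat //.
  by rewrite geq_max !leq_max leqnSn !orbT.
have c12 : 2 <= c1 by apply: lsi_const_ge2; rewrite ler1n leq_max.
have c1E : c1 = lsi_const R M by rewrite /c1 /M (maxn_idPr _).
have S0 : 0 <= S by apply: sumr_ge0 => x _; rewrite sqr_ge0.
have T0 : 0 <= T by apply: sumr_ge0 => x _.
pose b : R := Num.sqrt (S / M); pose t : R := T / M.
have b0 : 0 <= b by rewrite sqrtr_ge0.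
have t0 : 0 <= t by rewrite divr_ge0 // ltW.
have bE : b ^+ 2 = S / M by rewrite sqr_sqrtr // divr_ge0 // ltW.
have SE : S = M * b ^+ 2 by rewrite bE mulrC divfK ?gt_eqF.
have TE : T = M * t by rewrite /t mulrC divfK ?gt_eqF.
have tb : t <= b.
  rewrite -(@ler_pXn2r _ 2) // -(ler_pM2l M0) -SE.
  have : 0 <= \sum_(x in A :\ z) (u x - t) ^+ 2.
    by apply: sumr_ge0 => x _; rewrite sqr_ge0.
  under eq_bigr do rewrite sqrrB.
  rewrite big_split sumrB /= sumr_const cA' -[_ *+ m.+1]mulr_natl -/S -/M.
  rewrite sumrMnl -mulr_suml -/T TE; lra.
have bu : b <= u z.
  rewrite -(@ler_pXn2r _ 2) // ?nnegrE // bE ler_pdivrMr // mulr_natr -cA'.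
  rewrite -sumr_const; apply: ler_sum => x; rewrite !inE => /andP[_ xA].
  by rewrite ler_pXn2r ?nnegrE //; exact: zmax.
clearbody t b X S T M c0 c1; clear IH cA cA' sumD1.
have := two_point_lsi R M (u z) b M1; rewrite b0 bu => /(_ isT); rewrite -c1E.
(* Chain rule for entropy: [S * ln (S / M)] cancels when this is added to the induction
   hypothesis. *)
have -> : M * (b ^+ 2 * ln (b ^+ 2)) = S * ln (S / M) by rewrite mulrA -SE bE.
rewrite -SE => tp.
have gap : c0 * (S - T ^+ 2 / M) <= c1 * (S - T ^+ 2 / M).
  apply: ler_wpM2r => //.
  have -> : S - T ^+ 2 / M = M * (b ^+ 2 - t ^+ 2) by rewrite SE TE; field; lra.
  by rewrite mulr_ge0 ?subr_ge0 ?ler_pXn2r ?nnegrE // ltW.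
suff : c1 * (S - T ^+ 2 / M) + c1 * (M / (M + 1) * (u z - b) ^+ 2) <=
       c1 * (u z ^+ 2 + S - (u z + T) ^+ 2 / (M + 1)) by lra.
rewrite -mulrDr ler_wpM2l //; first lra.
rewrite -subr_ge0.
(* The slack from replacing [t] by [b] is nonnegative because [t <= b <= u z]. *)
have -> : u z ^+ 2 + S - (u z + T) ^+ 2 / (M + 1) -
    (S - T ^+ 2 / M + M / (M + 1) * (u z - b) ^+ 2) =
    M * ((b - t) * ((u z - b) + (u z - t))) / (M + 1).
  by rewrite SE TE; field; apply/andP; split; lra.
by do ?[apply: divr_ge0|apply: mulr_ge0]; lra.
Qed.

Lemma card_mul_Ent f : (forall x, 0 <= f x) ->
  #|V|%:R * Ent f =
  \sum_x f x * ln (f x) - (\sum_x f x) * ln ((\sum_x f x) / #|V|%:R).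
Proof.
move=> f0; rewrite /Ent {1}/unif_mean.
have [V0|VN0] := eqVneq #|V| 0%N.
  have E (g : V -> R) : \sum_x g x = 0.
    by apply: big1 => x; have := card0_eq V0 x; rewrite inE.
  by rewrite !E V0 !mul0r subr0.
have n0 : 0 < #|V|%:R :> R by rewrite ltr0n lt0n.
rewrite mulrC divfK ?gt_eqF // mulr_suml -sumrB.
apply: eq_bigr => x _; rewrite -mulrBr -/(unif_mean f).
have := f0 x; rewrite le_eqVlt => /predU1P[<-|fx]; first by rewrite !mul0r.
rewrite ln_div ?posrE // divr_gt0 //.
by rewrite (bigD1 x) //= ltr_pwDl // sumr_ge0.
Qed.

(** The case [u = sqrt f] on all of [V]; the bracket is [m + 1] times the variance of [u]. *)
Lemma complete_lsi m f : (0 < m)%N -> #|V| = m.+1 -> (forall x, 0 <= f x) ->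
  m.+1%:R * Ent f <= lsi_const R m%:R *
    (\sum_x f x - (\sum_x Num.sqrt (f x)) ^+ 2 / m.+1%:R).
Proof.
move=> m0 cV f0; rewrite -cV card_mul_Ent //.
have := @complete_lsi_set m [set: V] (fun x => Num.sqrt (f x))
  (fun x => sqrtr_ge0 _).
rewrite cardsT cV => /(_ erefl); rewrite (maxn_idPr m0).
under eq_bigr do rewrite sqr_sqrtr //.
under [X in _ - X * _ <= _]eq_bigr do rewrite sqr_sqrtr //.
under [X in ln (X / _)]eq_bigr do rewrite sqr_sqrtr //.
under [X in _ <= _ * (X - _)]eq_bigr do rewrite sqr_sqrtr //.
have E (g : V -> R) : \sum_(x in [set: V]) g x = \sum_x g x.
  by apply: eq_bigl => x; rewrite inE.
by rewrite !E.
Qed.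

End CompleteGraph.

(** * Edge entropies of the star and the two bounds *)

Section Star.
Variables (R : realType) (V : finType) (xs : V).
Implicit Types (f : V -> R).

Lemma ent_sym f x y : ent f x y = ent f y x.
Proof. by rewrite /ent addrC [f y + f x]addrC. Qed.

Lemma sum_star_ent f :
  \sum_x \sum_y star_graph R xs x y * ent f x y =
  2 * \sum_(y | y != xs) ent f xs y.
Proof.
rewrite (bigD1 xs) //= mulr2n mulrDl mul1r; congr (_ + _).
  rewrite (bigD1 xs) //= /star_weight eqxx mul0r add0r.
  by apply: eq_bigr => y yx; rewrite eq_sym yx mul1r.
apply: eq_bigr => x xN; rewrite (bigD1 xs) //= big1 => [|y yN].
  by rewrite /star_weight xN eqxx orbT mul1r addr0 ent_sym.
by rewrite /star_weight ![xs == _]eq_sym (negPf xN) (negPf yN) andbF mul0r.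
Qed.

(** Counting each edge in both orders supplies the factor 2 that cancels the [2^-1] in [ent]. *)
Lemma sum_star_ent_ge f : (forall x, 0 <= f x) ->
  ln 2 * \sum_x (Num.sqrt (f x) - Num.sqrt (f xs)) ^+ 2 <=
  \sum_x \sum_y star_graph R xs x y * ent f x y.
Proof.
move=> f0; rewrite sum_star_ent (bigD1 xs) //= subrr expr0n add0r !mulr_sumr.
apply: ler_sum => y _.
have := two_point_hellinger _ _ _ (sqrtr_ge0 (f xs)) (sqrtr_ge0 (f y)).
rewrite !sqr_sqrtr // => h.
have -> : (Num.sqrt (f y) - Num.sqrt (f xs)) ^+ 2 =
    (Num.sqrt (f xs) - Num.sqrt (f y)) ^+ 2.
  by ring.
by rewrite /ent; lra.
Qed.

End Star.

Theorem proposition2p10 (R : realType) (n : nat) (V : finType) (xs : V)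
  (hn : (3 <= n)%N) (hV : #|V| = n) :
  2 * ln 2 * (1 - 2 / n%:R) / ln (n%:R - 1) <= kappa (star_graph R xs) /\
  kappa (star_graph R xs) <= 2 * ln 2 / ln n%:R.
Proof.
have [|_ ineq largest] := @kappa_largest R V (star_graph R xs).
  by rewrite hV (ltn_trans _ hn).
have n3 : 3 <= n%:R :> R by rewrite ler_nat.
have n0 : 0 < n%:R :> R by lra.
have ln2 : 0 < ln 2 :> R by rewrite ln_gt0 // ltr1n.
have lnn : 0 < ln (n%:R - 1) :> R by rewrite ln_gt0 //; lra.
split; last first.
  have [z zN] : exists z, z \in [set~ xs].
    by apply/card_gt0P; rewrite cardsC1 hV; case: n hn {hV n3 n0 lnn} => [|[]].
  move: zN; rewrite !inE => zN.
  pose d x : R := (x == z)%:R.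
  have d0 x : 0 <= d x by rewrite ler0n.
  have dz : d z = 1 by rewrite /d eqxx.
  have dN x : x != z -> d x = 0 by rewrite /d => /negPf ->.
  have := ineq d d0; rewrite sum_star_ent hV (bigD1 z) //=.
  (* Only the edge joining the leaf [z] to the centre carries entropy. *)
  rewrite big1 => [|y /andP[yx yz]].
    have -> : ent d xs z = 2^-1 * ln 2.
      rewrite /ent dz dN 1?eq_sym // mul0r mulr0 !add0r mulr1 mul1r.
      by rewrite invrK mul1r.
    have -> : Ent d = ln n%:R / n%:R.
      have -> : Ent d = #|V|%:R^-1 * (#|V|%:R * Ent d).
        by rewrite mulKf // hV gt_eqF.
      have sumd : \sum_x d x = 1.
        by rewrite (bigD1 z) //= dz big1 ?addr0 // => x; exact: dN.
      have sumdln : \sum_x d x * ln (d x) = 0.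
        by apply: big1 => x _; rewrite /d; case: eqP => _;
          rewrite ?mul0r // ln1 mulr0.
      rewrite card_mul_Ent // sumd sumdln hV mul1r div1r lnV ?posrE; last lra.
      by rewrite sub0r opprK mulrC.
    have lnn' : 0 < ln n%:R :> R by rewrite ln_gt0 //; lra.
    rewrite ler_pdivlMr // addr0 mulrA ler_pdivrMr; last lra.
    have -> // : 2 / n%:R * (2 * (2^-1 * ln 2)) * n%:R = 2 * ln 2 :> R.
    by clear hV; field; lra.
  rewrite /ent dN 1?eq_sym // dN //.
  by rewrite !mul0r mulr0 addr0.
apply: largest.
  rewrite divr_ge0 ?ltW // mulr_gt0 ?mulr_gt0 // subr_gt0 ltr_pdivrMr; lra.
move=> f f0; rewrite hV.
case: n hn hV n3 n0 lnn => // m m2 hV n3 n0 lnn.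
have := complete_lsi R V m f (ltnW m2) hV f0.
set S := \sum_x f x; set T := \sum_x Num.sqrt (f x).
set N : R := m.+1%:R in n3 n0 lnn *.
have Nm : m%:R = N - 1 :> R by rewrite /N -natr1 addrK.
have -> : lsi_const R m%:R = N * ln (N - 1) / (N - 2).
  rewrite /lsi_const Nm ifN; first by congr (_ * _ / _); ring.
  by apply/eqP; lra.
move=> entle.
have star := sum_star_ent_ge R V xs f f0.
(* Squared deviations are smallest about the mean; centring at [xs] instead adds
   [(T - N * sqrt (f xs))^2 / N]. *)
have ST : S - T ^+ 2 / N <= \sum_x (Num.sqrt (f x) - Num.sqrt (f xs)) ^+ 2.
  under eq_bigr do rewrite sqrrB sqr_sqrtr //.
  rewrite big_split sumrB /= sumr_const hV -[_ *+ m.+1]mulr_natl -/S -/N.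
  rewrite sumrMnl -mulr_suml -/T.
  have := sqr_ge0 (T - N * Num.sqrt (f xs)).
  have N0 : 0 < N^-1 by rewrite invr_gt0; lra.
  rewrite -(pmulr_rge0 _ N0).
  have -> : N^-1 * (T - N * Num.sqrt (f xs)) ^+ 2 =
    T ^+ 2 / N - 2 * (T * Num.sqrt (f xs)) + N * Num.sqrt (f xs) ^+ 2.
    by clear hV; field; lra.
  clear - S; move: (Num.sqrt _) (T ^+ 2 / N) => c T2.
  lra.
have c0 : 0 <= N * ln (N - 1) / (N - 2) by rewrite divr_ge0 ?mulr_ge0 //; lra.
have {}entle := le_trans entle (ler_wpM2l c0 ST).
clear hV; set E := Ent f in entle *; set D := \sum_x _ ^+ 2 in entle star *.
(* This multiplier turns the left side of [entle] into the claimed constant times [E], and its right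
   side into [2 / N * (ln 2 * D)]. *)
have k0 : 0 <= 2 * ln 2 * (N - 2) / (N ^+ 2 * ln (N - 1)).
  by rewrite divr_ge0 ?mulr_ge0 ?sqr_ge0 //; lra.
apply: (@le_trans _ _ (2 / N * (ln 2 * D))); last first.
  by rewrite ler_wpM2l // divr_ge0 //; lra.
have := ler_wpM2l k0 entle; congr (_ <= _).
  by field; do ?[apply/andP; split]; lra.
by field; do ?[apply/andP; split]; lra.
Qed.
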